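(* Let $P\subseteq\mathbb{R}^{p+q}$ be a rational polyhedron. Then $P_I=P^{(1)}_{2^p}$, i.e. the mixed integer hull of $P$ equals the (first) $2^p$-disjunctive closure of $P$.
   Context: $P_I=\mathrm{conv}\{(x,y)\in P: x\in\mathbb{Z}^p\}$. A $k$-disjunction ($k\ge 2$) is a family of $k$ inequalities $d^1x\le\delta^1,\dots,d^kx\le\delta^k$ with $d^i\in\mathbb{Z}^p$ (row vectors, not necessarily distinct) and $\delta^i\in\mathbb{Z}$ such that every $x\in\mathbb{Z}^p$ satisfies $d^ix\le\delta^i$ for at least one $i$. For a closed convex set $C\subseteq\mathbb{R}^{p+q}$, an inequality $\alpha x+\beta y\le\gamma$ is a $k$-disjunctive cut for $C$ if it is not valid for $C$ and there is a $k$-disjunction such that every $(x,y)\in C$ with $\alpha x+\beta y>\gamma$ satisfies $d^ix>\delta^i$ for all $i$. The $k$-disjunctive closure $C^{(1)}_k$ is the intersection of $C$ with all half-spaces $\{\alpha x+\beta y\le\gamma\}$ given by $k$-disjunctive cuts for $C$; iteratively $C^{(0)}_k=C$ and $C^{(i)}_k$ is the $k$-disjunctive closure of $C^{(i-1)}_k$. *)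

(* Defs.v *)
(* Stdlib reals (R), with MathComp ordinals 'I_n only as finite index
   types for coordinates.  A point of R^(p+q) is a pair (x, y) with
   x : 'I_p -> R (integer-constrained part) and y : 'I_q -> R. *)
From Stdlib Require Import Reals ZArith List.
From mathcomp Require Import all_boot.
Set Implicit Arguments.
Unset Strict Implicit.
Open Scope R_scope.

Definition fsum (n : nat) (F : 'I_n -> R) : R :=
  fold_right Rplus 0 (List.map F (enum 'I_n)).

Definition dot (n : nat) (a x : 'I_n -> R) : R := fsum (fun i => Rmult (a i) (x i)).

Definition is_rational (r : R) : Prop :=
  exists (a b : Z), (b <> 0)%Z /\ r = IZR a / IZR b.

Definition mset (p q : nat) := ('I_p -> R) -> ('I_q -> R) -> Prop.

Definition rational_polyhedron (p q : nat) (P : mset p q) : Prop :=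
  exists (m : nat) (a : 'I_m -> 'I_p -> R) (c : 'I_m -> 'I_q -> R) (b : 'I_m -> R),
    (forall j i, is_rational (a j i)) /\ (forall j i, is_rational (c j i)) /\
    (forall j, is_rational (b j)) /\
    (forall x y, P x y <-> forall j, dot (a j) x + dot (c j) y <= b j).

Definition conv (p q : nat) (S : mset p q) : mset p q :=
  fun x y => exists l : list (R * (('I_p -> R) * ('I_q -> R))),
    (forall t, In t l -> 0 <= fst t /\ S (fst (snd t)) (snd (snd t))) /\
    fold_right Rplus 0 (List.map fst l) = 1 /\
    (forall i, x i = fold_right Rplus 0 (List.map (fun t => Rmult (fst t) (fst (snd t) i)) l)) /\
    (forall i, y i = fold_right Rplus 0 (List.map (fun t => Rmult (fst t) (snd (snd t) i)) l)).

Definition is_int_vec (n : nat) (x : 'I_n -> R) : Prop :=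
  forall i, exists z : Z, x i = IZR z.

Definition mixed_integer_hull (p q : nat) (P : mset p q) : mset p q :=
  conv (fun x y => P x y /\ is_int_vec x).

Definition is_k_disjunction (p k : nat) (d : 'I_k -> 'I_p -> Z) (delta : 'I_k -> Z) : Prop :=
  (2 <= k)%nat /\
  forall x : 'I_p -> Z, exists i : 'I_k,
    dot (fun j => IZR (d i j)) (fun j => IZR (x j)) <= IZR (delta i).

Definition is_k_disjunctive_cut (p q k : nat) (C : mset p q)
    (alpha : 'I_p -> R) (beta : 'I_q -> R) (gamma : R) : Prop :=
  (~ forall x y, C x y -> dot alpha x + dot beta y <= gamma) /\
  exists (d : 'I_k -> 'I_p -> Z) (delta : 'I_k -> Z),
    is_k_disjunction d delta /\
    forall x y, C x y -> dot alpha x + dot beta y > gamma ->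
      forall i, dot (fun j => IZR (d i j)) x > IZR (delta i).

Definition k_disjunctive_closure (p q k : nat) (C : mset p q) : mset p q :=
  fun x y => C x y /\
    forall alpha beta gamma, is_k_disjunctive_cut k C alpha beta gamma ->
      dot alpha x + dot beta y <= gamma.

(* Main.v *)
(* By Meyer's theorem the hull P_I is cut out by finitely many integral
   inequalities h <= 0: with Minkowski-Weyl, P is a bounded set plus a cone
   spanned by integral vectors, so P_I is the hull of the finitely many fibers
   of P over the integer points of a box, plus that cone.  A point of P outside
   P_I violates some h, scaled so that h > 1 there.  The projection to the
   x-space of P intersected with h >= 1 is a rational polyhedron without integer
   points, so by Doignon's theorem 2^p of its inequalities a x <= b already
   exclude all integer points.  Their integral negations - a x <= - b - 1 form a
   2^p-disjunction certifying the cut h <= 1.  For p = 0 there is no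
   k-disjunction with k = 2^p = 1, and both sides equal P. *)
Require Import Defs.
From Stdlib Require Import Reals ZArith List.
From mathcomp Require Import all_boot all_order all_algebra.
From mathcomp Require Import boolp Rstruct.
From mathcomp Require Import zify ring lra ssrZ.
Import Order.TTheory GRing.Theory Num.Theory.
Open Scope R_scope.

(** * Integral polyhedral cones: Fourier-Motzkin elimination and Minkowski-Weyl duality *)

Section Cones.
Local Set Implicit Arguments.
Local Unset Strict Implicit.
Local Open Scope ring_scope.
Variable F : archiRealFieldType.
Implicit Types I J T : finType.

Definition idot {I} (a : I -> int) (z : I -> F) : F := \sum_i (a i)%:~R * z i.

Definition intlin {I} (l : (I -> F) -> F) := exists a, forall z, l z = idot a z.

Lemma intlin_coord I (i : I) : intlin (fun z : I -> F => z i).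
Proof.
exists (fun j => (j == i)%:Z) => z; rewrite /idot (bigD1 i) //= eqxx mul1r.
by rewrite big1 ?addr0 // => j /negbTE ->; rewrite mul0r.
Qed.

Lemma intlin0 I : intlin (fun _ : I -> F => 0).
Proof. by exists (fun=> 0) => z; rewrite /idot big1 // => i _; rewrite mul0r. Qed.

Lemma intlinD I (l1 l2 : (I -> F) -> F) :
  intlin l1 -> intlin l2 -> intlin (fun z => l1 z + l2 z).
Proof.
move=> [a ha] [b hb]; exists (fun i => a i + b i) => z.
by rewrite ha hb /idot -big_split; apply: eq_bigr => i _; rewrite rmorphD mulrDl.
Qed.

Lemma intlinM I (c : int) (l : (I -> F) -> F) :
  intlin l -> intlin (fun z => c%:~R * l z).
Proof.
move=> [a ha]; exists (fun i => c * a i) => z.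
by rewrite ha /idot mulr_sumr; apply: eq_bigr => i _; rewrite rmorphM mulrA.
Qed.

Lemma intlinN I (l : (I -> F) -> F) : intlin l -> intlin (fun z => - l z).
Proof.
move=> /(intlinM (-1))[a ha]; exists a => z.
by rewrite -ha rmorphN1 mulN1r.
Qed.

Lemma intlinB I (l1 l2 : (I -> F) -> F) :
  intlin l1 -> intlin l2 -> intlin (fun z => l1 z - l2 z).
Proof. by move=> h1 h2; apply: intlinD => //; apply: intlinN. Qed.

Lemma intlin_sum I J (P : pred J) (l : J -> (I -> F) -> F) :
  (forall j, intlin (l j)) -> intlin (fun z => \sum_(j | P j) l j z).
Proof.
move=> /fin_all_exists[b hb]; exists (fun i => \sum_(j | P j) b j i) => z.
rewrite /idot (eq_bigr _ (fun j _ => hb j z)) exchange_big.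
by apply: eq_bigr => i _; rewrite rmorph_sum mulr_suml.
Qed.

Lemma intlin_comp I J (l : (I -> F) -> F) (f : (J -> F) -> I -> F) :
  intlin l -> (forall i, intlin (fun z => f z i)) -> intlin (fun z => l (f z)).
Proof.
move=> [a ha] hf.
have [b hb] : intlin (fun z => \sum_i (a i)%:~R * f z i).
  by apply: intlin_sum => i; apply: intlinM.
by exists b => z; rewrite -hb ha.
Qed.

(** Only homogeneous systems with integer coefficients occur; affine systems enter later through an
    extra coordinate set to 1 ([homog]). *)
Definition polyhedral {I} (S : (I -> F) -> Prop) :=
  exists s : seq (I -> int), forall z, S z <-> all (fun a => idot a z <= 0) s.

Lemma polyhedral_ext I (S S' : (I -> F) -> Prop) :
  (forall z, S z <-> S' z) -> polyhedral S -> polyhedral S'.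
Proof. by move=> e [s hs]; exists s => z; rewrite -e. Qed.

Lemma polyhedral_le0 I (l : (I -> F) -> F) :
  intlin l -> polyhedral (fun z => l z <= 0).
Proof. by move=> [a ha]; exists [:: a] => z; rewrite /= andbT ha. Qed.

Lemma polyhedral_and I (S S' : (I -> F) -> Prop) :
  polyhedral S -> polyhedral S' -> polyhedral (fun z => S z /\ S' z).
Proof.
move=> [s hs] [s' hs']; exists (s ++ s') => z; rewrite all_cat hs hs'.
by split => [[-> ->]|/andP].
Qed.

Lemma polyhedral_eq I (l l' : (I -> F) -> F) :
  intlin l -> intlin l' -> polyhedral (fun z => l z = l' z).
Proof.
move=> h h'; apply: (@polyhedral_ext _ (fun z => l z - l' z <= 0 /\ l' z - l z <= 0)).
  move=> z; rewrite !subr_le0; split=> [[h1 h2]|->//].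
  by apply/le_anti; rewrite h1.
by apply: polyhedral_and; apply: polyhedral_le0; apply: intlinB.
Qed.

Lemma polyhedral_forall I J (S : J -> (I -> F) -> Prop) :
  (forall j, polyhedral (S j)) -> polyhedral (fun z => forall j, S j z).
Proof.
move=> /fin_all_exists[s hs]; exists (flatten [seq s j | j <- enum J]) => z.
split=> [h|/allP h j].
  by apply/allP => a /flatten_mapP[j _ aj]; have /hs/allP := h j; apply.
apply/hs/allP => a aj; apply: h; apply/flatten_mapP.
by exists j; rewrite ?mem_enum.
Qed.

Lemma polyhedral_comp I J (S : (I -> F) -> Prop) (f : (J -> F) -> I -> F) :
  (forall i, intlin (fun z => f z i)) -> polyhedral S ->
  polyhedral (fun z => S (f z)).
Proof.
move=> hf [s hs].
have H a : exists b : J -> int, forall z, idot a (f z) = idot b z.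
  by apply: (@intlin_comp _ _ (fun z => idot a z)) => //; exists a.
have [g hg] := choice H.
exists [seq g a | a <- s] => z; rewrite hs all_map.
by rewrite (eq_all (a2 := preim g (fun a => idot a z <= 0))) // => a /=; rewrite hg.
Qed.

Lemma separate_seq (L U : seq F) :
  {in L & U, forall l u, l <= u} ->
  exists t, all (fun l => l <= t) L && all (fun u => t <= u) U.
Proof.
elim: L => [_|l L IH h].
  elim: U => [|u U [t ht]] /=; first by exists 0.
  exists (Num.min u t); rewrite ge_min lexx /=.
  by apply: sub_all ht => v /=; rewrite ge_min => ->; rewrite orbT.
have [|t /andP[hL hU]] := IH.
  by move=> a b aL; apply: h; rewrite inE aL orbT.
exists (Num.max l t) => /=; rewrite le_max lexx /=; apply/andP; split.
  by apply: sub_all hL => v /=; rewrite le_max => ->; rewrite orbT.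
apply/allP => u uU; rewrite ge_max (allP hU u uU) andbT.
by apply: h => //; rewrite inE eqxx.
Qed.

(** An admissible [t] lies above every [- u k / c k] with [c k < 0] and below every one with
    [0 < c k]. The pairwise conditions are cross-multiplied, so that integer coefficients stay
    integers under elimination. *)
Lemma fourier_motzkin (T : eqType) (s : seq T) (u c : T -> F) :
  (exists t, all (fun k => u k + c k * t <= 0) s) <->
  {in s, forall k, c k = 0 -> u k <= 0} /\
  {in s &, forall k l, 0 < c k -> c l < 0 -> c k * u l - c l * u k <= 0}.
Proof.
split=> [[t /allP h]|[h0 h]].
  split=> [k ks ck|k l ks ls ck cl]; first by have := h k ks; rewrite ck mul0r addr0.
  have := h k ks; have := h l ls => hl hk.
  have -> : c k * u l - c l * u k
    = c k * (u l + c l * t) + - c l * (u k + c k * t) by ring.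
  by rewrite -(addr0 0) lerD // mulr_ge0_le0 // ltW // oppr_gt0.
pose L := [seq - u k / c k | k <- [seq k <- s | c k < 0]].
pose U := [seq - u k / c k | k <- [seq k <- s | 0 < c k]].
have [_ _ /mapP[l + ->] /mapP[k + ->]|t /andP[/allP hL /allP hU]] :=
  @separate_seq L U.
  rewrite !mem_filter => /andP[cl ls] /andP[ck ks].
  rewrite ler_ndivrMr // mulrAC ler_pdivrMr //.
  have := h k l ks ls ck cl; lra.
exists t; apply/allP => k ks; have [ck|ck|ck] := ltgtP (c k) 0.
- have /hL : - u k / c k \in L by apply: map_f; rewrite mem_filter ck.
  by rewrite ler_ndivrMr // mulrC; lra.
- have /hU : - u k / c k \in U by apply: map_f; rewrite mem_filter ck.
  by rewrite ler_pdivlMr // mulrC; lra.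
- by rewrite ck mul0r addr0; apply: h0.
Qed.

Definition upd {I} (z : I -> F) i t : I -> F := fun j => if j == i then t else z j.

Lemma idot_upd I (a : I -> int) z i t :
  idot a (upd z i t) = idot a z - (a i)%:~R * z i + (a i)%:~R * t.
Proof.
rewrite /idot (bigD1 i) //= [in RHS](bigD1 i) //= /upd eqxx.
rewrite (eq_bigr (fun j => (a j)%:~R * z j)) => [|j /negbTE -> //].
by ring.
Qed.

Lemma polyhedral_ex1 I (S : (I -> F) -> Prop) (i : I) :
  polyhedral S -> polyhedral (fun z => exists t, S (upd z i t)).
Proof.
move=> [s hs].
pose zero := [seq a : I -> int <- s | a i == 0].
pose pos := [seq a : I -> int <- s | 0 < a i].
pose neg := [seq a : I -> int <- s | a i < 0].
(* Each paired combination has coefficient 0 at [i], so its value does not depend on the eliminated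
   coordinate. *)
exists (zero ++ [seq (fun j => a i * b j - b i * a j) | a <- pos, b <- neg]) => z.
have comb a b : idot (fun j => a i * b j - b i * a j) z =
    (a i)%:~R * (idot b z - (b i)%:~R * z i) -
    (b i)%:~R * (idot a z - (a i)%:~R * z i).
  transitivity ((a i)%:~R * idot b z - (b i)%:~R * idot a z); last by ring.
  rewrite /idot !mulr_sumr -sumrB; apply: eq_bigr => j _.
  by rewrite rmorphB !rmorphM /=; ring.
transitivity (exists t, all (fun a : I -> int =>
    (idot a z - (a i)%:~R * z i) + (a i)%:~R * t <= 0) s).
  split=> -[t ht]; exists t; move: ht; rewrite hs;
  by rewrite (eq_all (fun a => congr1 (fun x => x <= 0) (idot_upd a z i t))).
rewrite fourier_motzkin all_cat; split=> [[h0 h]|/andP[/allP h0 /all_allpairsP h]].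
  apply/andP; split.
    apply/allP => a; rewrite mem_filter => /andP[/eqP ai as_].
    by have := h0 a as_; rewrite ai mul0r subr0; apply.
  apply/all_allpairsP => a b; rewrite !mem_filter => /andP[ai as_] /andP[bi bs].
  by rewrite comb; apply: h => //; rewrite ?ltr0z ?ltrz0.
split=> [a as_ /eqP|a b as_ bs].
  rewrite intr_eq0 => ai; rewrite (eqP ai) mul0r subr0.
  by apply: h0; rewrite mem_filter ai.
rewrite ltr0z ltrz0 => ai bi; rewrite -comb.
by apply: h; rewrite mem_filter ?ai ?bi.
Qed.

Lemma polyhedral_exs I (S : (I -> F) -> Prop) (s : seq I) :
  polyhedral S ->
  polyhedral (fun z => exists z', (forall i, i \notin s -> z' i = z i) /\ S z').
Proof.
elim: s S => [|i s IH] S hS.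
  apply: polyhedral_ext hS => z; split=> [Sz|[z' [e Sz']]]; first by exists z.
  by have -> : z = z' by apply/funext => i; rewrite e.
apply: polyhedral_ext (IH _ (polyhedral_ex1 i hS)) => z.
split=> -[z' [e]] => [[t h]|h].
  exists (upd z' i t); split=> // j; rewrite inE negb_or => /andP[ji js].
  by rewrite /upd (negbTE ji) e.
exists (upd z' i (z i)); split=> [j js|].
  by rewrite /upd; case: eqVneq => [->//|ji]; apply: e; rewrite inE negb_or ji.
exists (z' i); congr S: h; apply/funext => j; rewrite /upd.
by case: eqP => // ->.
Qed.

Definition join {I J} (w : I -> F) (u : J -> F) (k : I + J) : F :=
  match k with inl i => w i | inr j => u j end.

Lemma polyhedral_proj I J (S : (I + J -> F) -> Prop) :
  polyhedral S -> polyhedral (fun w => exists u, S (join w u)).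
Proof.
move=> /(polyhedral_exs [seq inr j | j <- enum J]) h.
have : polyhedral (fun w : I -> F => exists z',
    (forall k, k \notin [seq inr j | j <- enum J] -> z' k = join w (fun=> 0) k) /\ S z').
  apply: (@polyhedral_comp _ _ _ (fun w => join w (fun=> 0))) h.
  by case=> [i|j]; [apply: intlin_coord|apply: intlin0].
apply: polyhedral_ext => w; split=> [[z' [e h']]|[u hu]].
  exists (fun j => z' (inr j)); congr S: h'; apply/funext => -[i|j] //=.
  by rewrite e //; apply/mapP => -[].
exists (join w u); split=> // -[i|j] //=.
by rewrite map_f // mem_enum.
Qed.

Definition cone {T I} (g : T -> I -> int) (z : I -> F) : Prop :=
  exists w : T -> F, (forall k, 0 <= w k) /\
    forall i, z i = \sum_k w k * (g k i)%:~R.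

(** The cone is the projection to [z] of the pairs (z, w) in which the nonnegative weights [w]
    represent [z]; these pairs form a polyhedral set. *)
Lemma weyl T I (g : T -> I -> int) : polyhedral (cone g).
Proof.
pose S (zw : I + T -> F) := (forall k, - zw (inr k) <= 0) /\
  forall i, zw (inl i) = \sum_k (g k i)%:~R * zw (inr k).
have /polyhedral_proj : polyhedral S.
  apply: polyhedral_and; apply: polyhedral_forall => k.
    by apply: polyhedral_le0; apply/intlinN/intlin_coord.
  apply: polyhedral_eq; first exact: intlin_coord.
  by apply: intlin_sum => i; apply/intlinM/intlin_coord.
apply: polyhedral_ext => z; split=> -[w [w0 hw]]; exists w; split=> [k|i].
- by have := w0 k; rewrite /= oppr_le0.
- by have /= -> := hw i; apply: eq_bigr => k _; rewrite mulrC.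
- by rewrite /= oppr_le0.
- by rewrite /= hw; apply: eq_bigr => k _; rewrite mulrC.
Qed.

Lemma cone_generator T I (g : T -> I -> int) k : cone g (fun i => (g k i)%:~R).
Proof.
exists (fun j => (j == k)%:R); split=> [j|i]; first exact: ler0n.
rewrite (bigD1 k) //= eqxx mul1r big1 ?addr0 // => j /negbTE ->.
by rewrite mul0r.
Qed.

Lemma cone_dot_le0 T I (g : T -> I -> int) x z :
  cone g x -> (forall k, idot (g k) z <= 0) -> \sum_i x i * z i <= 0.
Proof.
move=> [w [w0 hw]] h.
have -> : \sum_i x i * z i = \sum_k w k * idot (g k) z.
  rewrite (eq_bigr _ (fun i _ => congr1 (fun t => t * z i) (hw i))).
  rewrite (eq_bigr _ (fun i _ => mulr_suml _ _ _ _)) exchange_big /=.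
  apply: eq_bigr => k _; rewrite /idot mulr_sumr; apply: eq_bigr => i _.
  by rewrite mulrA.
by apply: sumr_le0 => k _; apply: mulr_ge0_le0.
Qed.

Lemma idotC I (a b : I -> int) :
  idot a (fun i => (b i)%:~R) = idot b (fun i => (a i)%:~R).
Proof. by apply: eq_bigr => i _; rewrite mulrC. Qed.

(* Polarity: if b lists the facets of the cone C spanned by the constraint
   vectors of S, then S is the cone D spanned by b, since every facet of D
   lies in C. *)
Lemma minkowski I (S : (I -> F) -> Prop) :
  polyhedral S -> exists (m : nat) (g : 'I_m -> I -> int), forall z, S z <-> cone g z.
Proof.
move=> [s hs]; pose vec (t : seq (I -> int)) (k : 'I_(size t)) := nth (fun=> 0) t k.
have vecP t (Q : (I -> int) -> bool) : (forall k, Q (vec t k)) <-> all Q t.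
  split=> [h|/all_nthP h k]; last exact: h.
  by apply/(all_nthP (fun=> 0)) => i it; have := h (Ordinal it).
have [b hb] := weyl (vec s); have [c hc] := weyl (vec b).
exists (size b), (vec b) => z; split=> [/hs/vecP sz|zb].
  rewrite hc; apply/vecP => l.
  apply: (cone_dot_le0 _ sz); rewrite hb; apply/vecP => k.
  by rewrite idotC; have /hc/vecP := cone_generator (vec b) k; apply.
apply/hs/vecP => k; rewrite /idot (eq_bigr _ (fun i _ => mulrC _ _)).
apply: (cone_dot_le0 zb) => l; rewrite -/(idot _ _).
by have /hb/vecP := cone_generator (vec s) k; apply.
Qed.
End Cones.

(** * Convex hulls and their translations *)

Section Hulls.
Local Set Implicit Arguments.
Local Unset Strict Implicit.
Local Open Scope ring_scope.
Variables (F : archiRealFieldType) (I : finType).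
Implicit Types (S : (I -> F) -> Prop) (z d : I -> F).

Definition homog z (k : option I) : F := if k is Some i then z i else 1.

(** Only points of positive weight have to lie in [S]; this allows quotients [Z f / nu f] as points
    even where the weight [nu f] vanishes. *)
Definition hull S z := exists (T : finType) (w : T -> F) (pt : T -> I -> F),
  [/\ forall k, 0 <= w k, forall k, 0 < w k -> S (pt k), \sum_k w k = 1 &
      forall i, z i = \sum_k w k * pt k i].

Lemma hull_mix S u v t : 0 <= t <= 1 -> hull S u -> hull S v ->
  hull S (fun i => t * u i + (1 - t) * v i).
Proof.
move=> /andP[t0 t1] [T1 [w1 [p1 [w1_0 p1S s1 e1]]]] [T2 [w2 [p2 [w2_0 p2S s2 e2]]]].
have t1' : 0 <= 1 - t by rewrite subr_ge0.
exists (T1 + T2)%type,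
  (fun k => match k with inl k => t * w1 k | inr k => (1 - t) * w2 k end),
  (fun k => match k with inl k => p1 k | inr k => p2 k end); split.
- by case=> k; apply: mulr_ge0.
- case=> k h; [apply: p1S|apply: p2S]; rewrite lt_def ?w1_0 ?w2_0 andbT;
  by apply: contraTneq h => ->; rewrite mulr0 ltxx.
- by rewrite big_sumType /= -!mulr_sumr s1 s2 !mulr1 addrC subrK.
- move=> i; rewrite big_sumType /= e1 e2 !mulr_sumr.
  by congr (_ + _); apply: eq_bigr => k _; rewrite mulrA.
Qed.

Lemma hull_translate S d : (forall z, S z -> S (fun i => z i + d i)) ->
  forall z, hull S z -> hull S (fun i => z i + d i).
Proof.
move=> hd z [T [w [p [w0 pS s e]]]]; exists T, w, (fun k i => p k i + d i).
split=> // [k wk|i]; first exact/hd/pS.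
rewrite (eq_bigr _ (fun k _ => mulrDr _ _ _)) big_split /= -e; congr (_ + _).
by rewrite -mulr_suml s mul1r.
Qed.

(** Iterating the translation reaches only natural multiples of [d]. For a natural n above r, the
    point z + r d lies on the segment from z to z + n d, and the hull is convex. *)
Lemma hull_ray S d r : 0 <= r -> (forall z, S z -> S (fun i => z i + d i)) ->
  forall z, hull S z -> hull S (fun i => z i + r * d i).
Proof.
move=> r0 hd z hz; pose n := Num.bound r.
have rn : r < n%:R by apply: archi_boundP.
have n0 : 0 < n%:R :> F by apply: le_lt_trans rn.
have hn : hull S (fun i => z i + n%:R * d i).
  apply: (@hull_translate S (fun i => n%:R * d i)) hz.
  elim: (n) => [|m IH] y hy.
    by congr S: hy; apply/funext => i; rewrite mul0r addr0.
  congr S: (hd _ (IH _ hy)); apply/funext => i.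
  by rewrite -addrA -natr1 mulrDl mul1r.
have t01 : 0 <= r / n%:R <= 1.
  by rewrite divr_ge0 ?(ltW n0) //= ler_pdivrMr // mul1r ltW.
congr (hull S): (hull_mix t01 hn hz); apply/funext => i.
by field; rewrite gt_eqF.
Qed.

Lemma hull_add_sum S J (s : seq J) (P : pred J) (d : J -> I -> F) :
  (forall j, P j -> forall z, hull S z -> hull S (fun i => z i + d j i)) ->
  forall z, hull S z -> hull S (fun i => z i + \sum_(j <- s | P j) d j i).
Proof.
move=> hd; elim: s => [|j s IH] z hz.
  by congr (hull S): hz; apply/funext => i; rewrite big_nil addr0.
case Pj: (P j).
  congr (hull S): (IH _ (hd _ Pj _ hz)); apply/funext => i.
  by rewrite big_cons Pj addrA.
by congr (hull S): (IH _ hz); apply/funext => i; rewrite big_cons Pj.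
Qed.

End Hulls.

(** * Meyer's theorem: a finite integral system for the mixed integer hull *)

Section Meyer.
Local Set Implicit Arguments.
Local Unset Strict Implicit.
Local Open Scope ring_scope.
Variables (F : archiRealFieldType) (X Y T : finType).
Variables (a : T -> X + Y -> int) (b : T -> int).
Local Notation I := (X + Y)%type.
Implicit Types (z d : I -> F) (u : option I -> F).

Definition feasible z := forall j, idot (a j) z <= (b j)%:~R.
Definition mixed_integer z := forall x : X, z (inl x) \is a Num.int.
Local Notation S := (fun z => feasible z /\ mixed_integer z).

Lemma idotD (a' : I -> int) z d :
  idot a' (fun i => z i + d i) = idot a' z + idot a' d.
Proof. by rewrite /idot -big_split; apply: eq_bigr => i _; rewrite mulrDr. Qed.

Lemma idotZ (a' : I -> int) (r : F) d :
  idot a' (fun i => r * d i) = r * idot a' d.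
Proof. by rewrite /idot mulr_sumr; apply: eq_bigr => i _; rewrite mulrCA. Qed.

(** The slice [u None = 1] is the polyhedron, and the slice [u None = 0] is the cone of directions
    satisfying [a j d <= 0] for all [j]. *)
Definition homog_cone u := (forall j,
  idot (a j) (u \o Some) - (b j)%:~R * u None <= 0) /\ - u None <= 0.

Lemma polyhedral_homog_cone : polyhedral homog_cone.
Proof.
apply: polyhedral_and; last by apply: polyhedral_le0; apply/intlinN/intlin_coord.
apply: polyhedral_forall => j; apply/polyhedral_le0/intlinB.
  by apply: intlin_sum => i; apply/intlinM/intlin_coord.
exact/intlinM/intlin_coord.
Qed.

Lemma homog_coneP z : homog_cone (homog z) <-> feasible z.
Proof.
rewrite /homog_cone /= oppr_le0 ler01; split=> [[h _] j|h].
  by have := h j; rewrite mulr1 subr_le0.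
by split=> // j; rewrite mulr1 subr_le0.
Qed.

Lemma recession_translate d : (forall j, idot (a j) d <= 0) -> mixed_integer d ->
  forall z, S z -> S (fun i => z i + d i).
Proof.
move=> hd di z [hz zi]; split=> [j|x]; last exact: rpredD.
by rewrite idotD -(addr0 (b j)%:~R) lerD.
Qed.

Section Model.
Variables (N B : nat) (g : 'I_N -> option I -> int).

(** Shifting the values 0, ..., 2B by -B enumerates the integer vectors of the cube [-B, B]^X. *)
Definition box (f : {ffun X -> 'I_B.*2.+1}) (x : X) : int := (f x)%:Z - B%:Z.

Local Notation FF := {ffun X -> 'I_B.*2.+1}.
Local Notation V := (FF + (FF * I) + 'I_N)%type.

(* The mixed integer points whose integer part lies in a box, together with
   the integral rays among [g]; perspective weights [v (inl (inl f))] make the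
   convex hull of the fibers over the points [f] of the box linear. *)
Definition model u := exists v : V -> F,
  [/\ forall f, 0 <= v (inl (inl f)),
      forall k, 0 <= v (inr k),
      \sum_f v (inl (inl f)) = u None,
      forall f, (forall x, v (inl (inr (f, inl x))) = (box f x)%:~R * v (inl (inl f))) /\
        (forall j, idot (a j) (fun i => v (inl (inr (f, i)))) <= (b j)%:~R * v (inl (inl f))) &
      forall i, u (Some i) = \sum_f v (inl (inr (f, i))) +
        \sum_(k | g k None == 0) (g k (Some i))%:~R * v (inr k)].

Lemma polyhedral_model : polyhedral model.
Proof.
pose M (u : option I + V -> F) := (forall f, - u (inr (inl (inl f))) <= 0) /\
  (forall k, - u (inr (inr k)) <= 0) /\
  (\sum_f u (inr (inl (inl f))) = u (inl None)) /\
  (forall f, (forall x, u (inr (inl (inr (f, inl x)))) = (box f x)%:~R * u (inr (inl (inl f)))) /\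
    (forall j, idot (a j) (fun i => u (inr (inl (inr (f, i))))) -
       (b j)%:~R * u (inr (inl (inl f))) <= 0)) /\
  forall i, u (inl (Some i)) = \sum_f u (inr (inl (inr (f, i)))) +
        \sum_(k | g k None == 0) (g k (Some i))%:~R * u (inr (inr k)).
have /polyhedral_proj : polyhedral M.
  apply: polyhedral_and.
    by apply: polyhedral_forall => f; apply/polyhedral_le0/intlinN/intlin_coord.
  apply: polyhedral_and.
    by apply: polyhedral_forall => f; apply/polyhedral_le0/intlinN/intlin_coord.
  apply: polyhedral_and.
    apply: polyhedral_eq; last exact: intlin_coord.
    by apply: intlin_sum => f; apply: intlin_coord.
  apply: polyhedral_and; apply: polyhedral_forall => f.
    apply: polyhedral_and; apply: polyhedral_forall => j.
      by apply: polyhedral_eq; [|apply/intlinM]; apply: intlin_coord.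
    apply/polyhedral_le0/intlinB; last exact/intlinM/intlin_coord.
    by apply: intlin_sum => i; apply/intlinM/intlin_coord.
  apply: polyhedral_eq; first exact: intlin_coord.
  apply: intlinD; first by apply: intlin_sum => f'; apply: intlin_coord.
  by apply: intlin_sum => i; apply/intlinM/intlin_coord.
apply: polyhedral_ext => u; split=> -[v].
  move=> [h1 [h2 [h3 [h4 h5]]]]; exists v; split=> //= [f|k|f].
  - by have := h1 f; rewrite oppr_le0.
  - by have := h2 k; rewrite oppr_le0.
  - have [h41 h42] := h4 f; split=> // j.
    by rewrite -subr_le0; apply: h42.
move=> [h1 h2 h3 h4 h5]; exists v; split=> [f|]; first by rewrite oppr_le0 /=.
split=> [f|]; first by rewrite oppr_le0 /=.
split=> //; split=> // f; have [h41 h42] := h4 f; split=> // j.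
by rewrite subr_le0.
Qed.

Hypothesis gK : forall u, homog_cone u <-> cone g u.

Lemma generatorP k : (forall j, idot (F := F) (a j) (fun i => (g k (Some i))%:~R) <=
  (b j)%:~R * (g k None)%:~R) /\ 0 <= g k None.
Proof.
have /gK[h1 h2] := cone_generator F g k; split=> [j|].
  by have := h1 j; rewrite subr_le0.
by rewrite -(ler0z F) -oppr_le0.
Qed.

(** A fiber of positive weight contributes the mixed integer point [Z f / nu f]. If [nu f = 0], then
    [Z f] is a recession direction with zero integer part, and translating by it preserves the hull.
    Integral rays with real weights are added by [hull_ray]. *)
Lemma model_hull z : model (homog z) -> hull S z.
Proof.
move=> [v [v0 r0 s1 hZ hz]]; pose nu f := v (inl (inl f)).
pose Z f i := v (inl (inr (f, i))).
have base : hull S (fun i => \sum_f nu f * (Z f i / nu f)).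
  exists FF, nu, (fun f i => Z f i / nu f); split=> // f nuf.
  have [h1 h2] := hZ f; split=> [j|x]; last first.
    by rewrite /Z h1 mulfK ?gt_eqF // intr_int.
  rewrite (_ : (fun i => _) = fun i => (nu f)^-1 * Z f i); last first.
    by apply/funext => i; rewrite mulrC.
  by rewrite idotZ mulrC ler_pdivrMr.
have rec f : nu f == 0 -> forall z, hull S z -> hull S (fun i => z i + Z f i).
  move=> /eqP nuf; apply/hull_translate/recession_translate.
    by move=> j; have [_ /(_ j)] := hZ f; rewrite -/(nu f) nuf mulr0.
  by move=> x; have [/(_ x)] := hZ f; rewrite /Z => -> _; rewrite -/(nu f) nuf mulr0.
have ray k : g k None == 0 -> forall z, hull S z ->
    hull S (fun i => z i + (g k (Some i))%:~R * v (inr k)).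
  move=> /eqP gk y hy; have [hg _] := generatorP k.
  rewrite (_ : (fun i => _) = fun i => y i + v (inr k) * (g k (Some i))%:~R); last first.
    by apply/funext => i; rewrite mulrC.
  apply: hull_ray hy => //; apply: recession_translate => [j|x]; last exact: intr_int.
  by have := hg j; rewrite gk mulr0.
have := hull_add_sum (index_enum 'I_N) ray
  (hull_add_sum (index_enum FF) rec base).
congr (hull S); apply/funext => i; have /= -> := hz i; congr (_ + _).
rewrite [RHS](bigID (fun f => nu f == 0)) /= addrC; congr (_ + _).
rewrite (bigID (fun f => nu f == 0)) /= big1 ?add0r => [|f /eqP->]; last by rewrite mul0r.
by apply: eq_bigr => f nuf; rewrite mulrC divfK.
Qed.

Hypothesis gB : forall x, \sum_k `|g k (Some (inl x))| <= B%:Z.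

(** Write [z] through the generators and split off the integer parts of the weights on the rays. The
    remainder [z'] keeps an integral x part, and its weights are at most 1, so [gB] puts that x part
    in the box. Hence a single fiber, with weight 1, suffices. *)
Lemma mixed_integer_model z : S z -> model (homog z).
Proof.
move=> [/homog_coneP/gK[w [w0 hw]] zi].
pose w' k := if g k None == 0 then w k - (Num.floor (w k))%:~R else w k.
pose z' i := \sum_k w' k * (g k (Some i))%:~R.
have w'0 k : 0 <= w' k by rewrite /w'; case: ifP; rewrite // subr_ge0 Num.Theory.floor_le.
have s1 : \sum_k w' k * (g k None)%:~R = 1.
  rewrite -[RHS]/(homog z None) hw; apply: eq_bigr => k _.
  by rewrite /w'; case: eqP => // ->; rewrite !mulr0.
have w'1 k : w' k <= 1.
  rewrite /w'; case: eqP => [_|/eqP gk].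
    by rewrite lerBlDl -[1]/(1%:~R) -rmorphD ltW // floorD1_gt.
  (* A generator that is not a ray has [g k None >= 1], and the products of weights and [g k None]
     sum to 1, so its weight is already at most 1 without rounding. *)
  have gk1 : (1 : F) <= (g k None)%:~R.
    by rewrite ler1z; have [_] := generatorP k; lia.
  rewrite -[leRHS]/(homog z None) hw (bigD1 k) //=.
  rewrite -[leLHS]addr0 lerD //; first by rewrite ler_peMr.
  by apply: sumr_ge0 => l _; rewrite mulr_ge0 // ler0z; have [] := generatorP l.
have zz' i : z i = z' i + \sum_(k | g k None == 0) (g k (Some i))%:~R * (Num.floor (w k))%:~R.
  have /= -> := hw (Some i); rewrite /z' [X in _ + X]big_mkcond -big_split /=.
  by apply: eq_bigr => k _; rewrite /w'; case: ifP => _; ring.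
have z'F : feasible z'.
  apply/homog_coneP/gK; exists w'; split=> // -[i|] //=.
have z'i : mixed_integer z'.
  move=> x; rewrite -[z' _](addrK (\sum_(k | g k None == 0)
    (g k (Some (inl x)))%:~R * (Num.floor (w k))%:~R)) -zz'.
  by rewrite rpredB // rpred_sum // => k _; rewrite -rmorphM intr_int.
have z'B x : `|z' (inl x)| <= B%:Z%:~R.
  apply: le_trans (_ : (\sum_k `|g k (Some (inl x))|)%:~R <= _); last by rewrite ler_int.
  apply: le_trans (ler_norm_sum _ _ _) _; rewrite rmorph_sum ler_sum // => k _.
  by rewrite normrM ger0_norm // -intr_norm ler_piMl.
pose f0 : FF := [ffun x => inord `|Num.floor (z' (inl x)) + B%:Z|].
have f0E x : (box f0 x)%:~R = z' (inl x).
  have /intrP[n zn] := z'i x; have := z'B x; rewrite /box ffunE zn.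
  rewrite intrKfloor -intr_norm ler_int => nB; congr (_%:~R).
  by rewrite inordK; lia.
exists (fun k => match k with
  | inl (inl f) => (f == f0)%:R
  | inl (inr (f, i)) => (f == f0)%:R * z' i
  | inr k => (Num.floor (w k))%:~R end); split=> /=.
- by move=> f; apply: ler0n.
- by move=> k; rewrite ler0z floor_ge0.
- by rewrite (bigD1 f0) //= eqxx big1 ?addr0 // => f /negbTE ->.
- move=> f; case: eqVneq => [->|_]; split=> [x|j].
  + by rewrite mul1r mulr1 f0E.
  + by rewrite idotZ mul1r mulr1; apply: z'F.
  + by rewrite mul0r mulr0.
  + by rewrite idotZ mul0r mulr0.
move=> i; rewrite zz'; congr (_ + _).
by rewrite (bigD1 f0) //= eqxx mul1r big1 ?addr0 // => f /negbTE ->; rewrite mul0r.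
Qed.

End Model.

(** The model contains [S] and is contained in its hull, so the inequalities describing the model
    serve as [h]. *)
Theorem meyer : exists (h : seq (option I -> int)),
  (forall z, S z -> all (fun h => idot h (homog z) <= 0) h) /\
  (forall z, all (fun h => idot h (homog z) <= 0) h -> hull S z).
Proof.
have [N [g gK]] := minkowski polyhedral_homog_cone.
(* Summing over all integer coordinates gives one bound valid for each of them. *)
pose B := (\sum_x \sum_k `|g k (Some (inl x))|)%N.
have [h hM] := polyhedral_model B g.
exists h; split=> z; rewrite -hM; last exact: model_hull.
apply: mixed_integer_model => // x.
rewrite /B (bigD1 x) //= PoszD -[leLHS]addr0 lerD //.
by rewrite (big_morph Posz PoszD (erefl _)); apply: ler_sum => k _; rewrite abszE.
Qed.

End Meyer.

(** * Doignon's theorem, the integer analogue of Helly's theorem *)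

Section Doignon.
Local Set Implicit Arguments.
Local Unset Strict Implicit.
Local Open Scope ring_scope.
Variables (X T : finType) (a : T -> X -> int).
Implicit Types (A : {set T}) (b : T -> int).

Local Notation ev k x := (\sum_i a k i * x i).

Definition int_infeasible A b :=
  forall x : X -> int, exists2 k, k \in A & b k < ev k x.

(* If no right-hand side can be relaxed, the points witnessing this are
   pairwise incongruent modulo 2: the midpoint of two congruent ones would be
   feasible. *)
Lemma tight_infeasible_card A b : int_infeasible A b ->
  (forall k, k \in A -> ~ int_infeasible A (fun l => b l + (l == k)%:Z)) ->
  (#|A| <= 2 ^ #|X|)%N.
Proof.
move=> hb tight.
(* Relaxing inequality [k] by one admits an integer point [y k], which exceeds at most the [k]-th
   bound, and by at most 1. *)
have /choice[y hy] : forall k, exists y : X -> int,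
    k \in A -> forall l, l \in A -> ev l y <= b l + (l == k)%:Z.
  move=> k; case kA: (k \in A); last by exists (fun=> 0).
  apply: contrapT => hk; apply: (tight k kA) => x; apply: contrapT => hx.
  apply: hk; exists x => _ l lA; rewrite leNgt; apply/negP => h.
  by apply: hx; exists l.
pose parity k : {ffun X -> bool} := [ffun i => odd `|y k i|].
have -> : (2 ^ #|X|)%N = #|{ffun X -> bool}| by rewrite card_ffun card_bool.
apply: (@leq_card_in _ _ parity) => k l kA lA /ffunP hkl.
apply/eqP; apply: contrapT => /negP kl.
have /choice[w hw] : forall i, exists w, y k i + y l i = 2 * w.
  move=> i; have := hkl i; rewrite !ffunE => hi.
  by exists ((y k i + y l i) %/ 2)%Z; lia.
have [j jA] := hb w; apply/negP; rewrite -leNgt.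
have e : ev j (y k) + ev j (y l) = 2 * ev j w.
  by rewrite -big_split mulr_sumr; apply: eq_bigr => i _ /=; rewrite -mulrDr hw; ring.
(* As [k] and [l] differ, the two values at [j] sum to at most 2 b j + 1; this sum is twice an
   integer, so the midpoint satisfies inequality [j]. *)
have := hy k kA j jA; have := hy l lA j jA.
case: (eqVneq j k) => [jk|_]; case: (eqVneq j l) => [jl|_]; try lia.
by case/negP: kl; rewrite -jk -jl.
Qed.

(** Relax right-hand sides by one as long as the system stays infeasible; the final system is tight.
    Since [x k] satisfies all other inequalities, it still violates the relaxed [k]-th one, so each
    relaxation lowers [slack] and the process ends. *)
Lemma critical_infeasible_card A b (x : T -> X -> int) : int_infeasible A b ->
  (forall k l, k \in A -> l \in A -> l != k -> ev l (x k) <= b l) ->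
  (#|A| <= 2 ^ #|X|)%N.
Proof.
pose slack b := (\sum_(k in A) `|ev k (x k) - b k|)%N.
have [n] := ubnP (slack b); elim: n b => // n IH b bn hb hx.
have [[k kA hk]|tight] := pselect (exists2 k, k \in A &
    int_infeasible A (fun l => b l + (l == k)%:Z)); last first.
  by apply: (tight_infeasible_card hb) => k kA hk; apply: tight; exists k.
apply: (IH _ _ hk) => [|k' l k'A lA lk]; last first.
  by have := hx k' l k'A lA lk; lia.
rewrite -ltnS; apply: leq_trans bn; rewrite ltnS /slack (bigD1 k) //= [leqRHS](bigD1 k) //= -addSn.
have [l lA] := hk (x k); case: (eqVneq l k) => [->|lk] h; last first.
  by have := hx k l kA lA lk; lia.
rewrite eqxx; apply: leq_add; first by move: (\sum_i _) h => e /= h; lia.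
by apply: leq_sum => i /andP[_ /negbTE ->]; rewrite addr0.
Qed.

(** Drop inequalities while infeasibility persists. In the critical set reached, dropping [k] admits
    an integer point satisfying all the others, as [critical_infeasible_card] requires. *)
Theorem doignon b : int_infeasible [set: T] b ->
  exists f : 'I_(2 ^ #|X|) -> T, forall x : X -> int, exists i, b (f i) < ev (f i) x.
Proof.
move=> hT.
have [A hA cardA] : exists2 A, int_infeasible A b & (#|A| <= 2 ^ #|X|)%N.
  have [n] := ubnP #|[set: T]|; elim: n [set: T] hT => // n IH A hA An.
  have [[k kA hk]|crit] := pselect (exists2 k, k \in A & int_infeasible (A :\ k) b).
    by apply: IH hk _; move: An; rewrite (cardsD1 k A) kA.
  exists A => //.
  have /choice[x hx] : forall k, exists x : X -> int,
      k \in A -> forall l, l \in A -> l != k -> ev l x <= b l.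
    move=> k; case kA: (k \in A); last by exists (fun=> 0).
    apply: contrapT => hk; apply: crit; exists k => // x; apply: contrapT => h.
    apply: hk; exists x => _ l lA lk; rewrite leNgt; apply/negP => hl.
    by apply: h; exists l => //; rewrite in_setD1 lk.
  by apply: (critical_infeasible_card hA (x := x)) => k l kA; apply: hx.
(* Infeasibility at the origin shows that [A] is nonempty; its member [k0] pads the enumeration to
   length 2^#|X|. *)
have [k0 k0A _] := hA (fun=> 0).
exists (fun i => nth k0 (enum A) i) => x; have [k kA hk] := hA x.
have lt : (index k (enum A) < 2 ^ #|X|)%N.
  by apply: leq_trans cardA; rewrite cardE index_mem mem_enum.
by exists (Ordinal lt); rewrite /= nth_index ?mem_enum.
Qed.
End Doignon.

(** * From a valid inequality to a disjunction *)

Section Certificate.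
Local Set Implicit Arguments.
Local Unset Strict Implicit.
Local Open Scope ring_scope.
Variables (F : archiRealFieldType) (X Y T : finType).
Variables (a : T -> X + Y -> int) (b : T -> int).
Implicit Type z : X + Y -> F.

Lemma idot_homog (I : finType) (c : option I -> int) (z : I -> F) :
  idot c (homog z) = (c None)%:~R + \sum_i (c (Some i))%:~R * z i.
Proof.
rewrite /idot (bigD1 None) //= mulr1; congr (_ + _).
rewrite (reindex_omap Some id) => [|[]] //=.
by apply: eq_bigl => i; rewrite eqxx.
Qed.

Lemma disjunction_of_valid (h : option (X + Y) -> int) :
  (forall z, feasible a b z /\ mixed_integer z -> idot h (homog z) <= 0) ->
  exists (d : 'I_(2 ^ #|X|) -> X -> int) (delta : 'I_(2 ^ #|X|) -> int),
    (forall x : X -> int, exists i, \sum_j d i j * x j <= delta i) /\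
    (forall z, feasible a b z -> 1 <= idot h (homog z) ->
       forall i, (delta i)%:~R < \sum_j (d i j)%:~R * z (inl j)).
Proof.
move=> hv.
(* [lift] regroups the coordinates so that the homogenizing one stays with the x part when y is
   projected away. In [Q] the condition h >= 1 is homogenized to h >= [u (inl None)]. *)
pose lift (u : option X + Y -> F) (k : option (X + Y)) := match k with
  | Some (inl x) => u (inl (Some x)) | Some (inr y) => u (inr y)
  | None => u (inl None) end.
pose Q (u : option X + Y -> F) :=
  homog_cone a b (lift u) /\ u (inl None) - idot h (lift u) <= 0.
have [s hs] : polyhedral (fun u : option X -> F => exists y, Q (join u y)).
  apply: polyhedral_proj.
  have hl k : intlin (fun u => lift u k).
    by case: k => [[x|y]|]; apply: intlin_coord.
  apply: polyhedral_and; first exact: (polyhedral_comp hl (polyhedral_homog_cone _ a b)).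
  apply/polyhedral_le0/intlinB; first exact: intlin_coord.
  by apply: intlin_sum => k; apply: intlinM.
have lift_homog x (y : Y -> F) : lift (join (homog x) y) = homog (join x y).
  by apply/funext => -[[]|].
pose c (k : 'I_(size s)) := nth (fun=> 0) s k.
have [x|f hf] := @doignon X 'I_(size s) (fun k j => c k (Some j)) (fun k => - c k None).
  apply: contrapT => hx.
  have /hs[y []] : all (fun c => idot c (homog (fun j => (x j)%:~R : F)) <= 0) s.
    apply/(all_nthP (fun=> 0)) => i si; rewrite leNgt; apply/negP => hi.
    apply: hx; exists (Ordinal si); rewrite // -subr_gt0 opprK addrC -(ltr0z F).
    move: hi; rewrite idot_homog rmorphD rmorph_sum.
    by rewrite (eq_bigr _ (fun j _ => rmorphM intr _ _)).
  (* An integer point of the projection lifts to a mixed integer feasible point with h >= 1, whereas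
     [hv] gives h <= 0 there. *)
  rewrite lift_homog => /homog_coneP fz; apply/negP; rewrite -ltNge subr_gt0.
  apply: le_lt_trans ltr01; by apply: hv; split=> // j; apply: intr_int.
(* For integers, violating c x <= - c0 means - c x <= c0 - 1. A point of the projection satisfies -
   c x >= c0, hence the strict inequality required. *)
exists (fun i j => - c (f i) (Some j)), (fun i => c (f i) None - 1); split=> [x|z fz hz i].
  have [i hi] := hf x; exists i; move: hi => /=.
  by rewrite (eq_bigr _ (fun j _ => mulNr _ _)) sumrN lerNl opprB addrC lezD1.
have /hs/(all_nthP (fun=> 0)) : exists y, Q (join (homog (fun j => z (inl j))) y).
  exists (fun y => z (inr y)); rewrite /Q lift_homog.
  have -> : join (fun j => z (inl j)) (fun y => z (inr y)) = z by apply/funext => -[].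
  by split; [apply/homog_coneP|rewrite subr_le0].
move=> /(_ (f i) (ltn_ord _)); rewrite -/(c _) idot_homog => le0.
rewrite (eq_bigr (fun j => - ((c (f i) (Some j))%:~R * z (inl j)))); last first.
  by move=> j _; rewrite rmorphN mulNr.
by rewrite sumrN rmorphB /= rmorph1; lra.
Qed.
End Certificate.

(** * Transfer to the definitions over the Stdlib reals, and the two inclusions *)

Section Bridge.
Local Set Implicit Arguments.
Local Unset Strict Implicit.
Local Open Scope ring_scope.

Lemma fold_right_Rplus (U : Type) (f : U -> R) (s : seq U) :
  fold_right Rplus R0 (List.map f s) = \sum_(t <- s) f t.
Proof. by elim: s => [|t s IH]; rewrite ?big_nil // big_cons -IH. Qed.

Lemma dotE n (a x : 'I_n -> R) : dot a x = \sum_i a i * x i.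
Proof. by rewrite /dot /fsum fold_right_Rplus big_enum. Qed.

Lemma IZR_int (n : int) : IZR (Z_of_int n) = n%:~R.
Proof.
have IZR_nat (m : nat) : IZR (Z.of_nat m) = m%:R by rewrite -INR_IZR_INZ INRE.
case: n => m; first exact: IZR_nat.
by rewrite NegzE !raddfN [LHS]opp_IZR [IZR _]IZR_nat.
Qed.

Lemma IZR_Z (n : Z) : IZR n = (int_of_Z n)%:~R.
Proof. by rewrite -IZR_int int_of_ZK. Qed.

Lemma is_rationalP (r : R) : is_rational r ->
  exists (n : nat) (s : int), (0 < n)%N /\ n%:R * r = s%:~R.
Proof.
move=> [x [y [y0 ->]]]; exists `|int_of_Z y|%N, (Num.sg (int_of_Z y) * int_of_Z x).
have yn : int_of_Z y != 0 by apply/eqP => e; apply: y0; rewrite -(int_of_ZK y) e.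
split; first by rewrite absz_gt0.
rewrite !IZR_Z RdivE natr_absz normrEsg !rmorphM /=.
by field; rewrite intr_eq0.
Qed.

Lemma common_denominator (T : finType) (r : T -> R) :
  (forall k, is_rational (r k)) ->
  exists (n : nat) (s : T -> int), (0 < n)%N /\ forall k, n%:R * r k = (s k)%:~R.
Proof.
move=> hr; have /fin_all_exists[n /fin_all_exists[s hs]] := fun k => is_rationalP (hr k).
exists (\prod_k n k)%N, (fun k => (\prod_(l | l != k) n l)%N%:Z * s k); split.
  by rewrite prodn_gt0 // => k; have [] := hs k.
move=> k; rewrite (bigD1 k) //= natrM rmorphM /= mulrAC.
by have [_ ->] := hs k; rewrite mulrC.
Qed.

Variables p q : nat.
Implicit Type z : 'I_p + 'I_q -> R.
Local Notation fst_part z := (fun i => z (inl i)).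
Local Notation snd_part z := (fun i => z (inr i)).

Lemma idot_dot (a : 'I_p + 'I_q -> int) x y :
  idot a (join x y) =
  dot (fun i => (a (inl i))%:~R) x + dot (fun i => (a (inr i))%:~R) y.
Proof. by rewrite /idot big_sumType !dotE. Qed.

(** Each row is multiplied by a common denominator of its coefficients and right-hand side. *)
Lemma rational_polyhedron_feasible (P : mset p q) : rational_polyhedron P ->
  exists m (a : 'I_m -> 'I_p + 'I_q -> int) (b : 'I_m -> int),
    forall x y, P x y <-> feasible a b (join x y).
Proof.
move=> [m [a [c [b [ha [hc [hb hP]]]]]]].
have /fin_all_exists[n /fin_all_exists[s hs]] : forall j : 'I_m,
    exists (n : nat) (s : option ('I_p + 'I_q) -> int), (0 < n)%N /\ forall k,
    n%:R * (match k with None => b j | Some (inl i) => a j i | Some (inr i) => c j i end)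
      = (s k)%:~R.
  by move=> j; apply: common_denominator => -[[i|i]|].
exists m, (fun j k => s j (Some k)), (fun j => s j None) => x y; rewrite hP.
suff e j : (dot (a j) x + dot (c j) y <= b j) <->
    idot (fun k => s j (Some k)) (join x y) <= (s j None)%:~R.
  by split=> h j; [apply/e/RleP/h|apply/RleP/e/h].
have [n0 hsj] := hs j.
have -> : idot (fun k => s j (Some k)) (join x y) =
    (n j)%:R * (dot (a j) x + dot (c j) y).
  rewrite /idot big_sumType mulrDr !dotE !mulr_sumr /=.
  by congr (_ + _); apply: eq_bigr => i _; rewrite -hsj mulrA.
by rewrite -(hsj None) ler_pM2l ?ltr0n.
Qed.

(** Indices of weight zero are filtered out, because [conv] demands that every listed point lie in
    [S]. *)
Lemma hull_conv (S : mset p q) z :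
  hull (fun z => S (fst_part z) (snd_part z)) z -> conv S (fst_part z) (snd_part z).
Proof.
move=> [T [w [pt [w0 wS w1 e]]]].
pose s := [seq k <- index_enum T | 0 < w k].
have sumE (f : T -> R) : \sum_(k <- s) w k * f k = \sum_k w k * f k.
  rewrite big_filter [RHS](bigID (fun k => 0 < w k)) /= [X in _ + X]big1 ?addr0 //.
  by move=> k; rewrite lt_def w0 andbT negbK => /eqP ->; rewrite mul0r.
exists (List.map (fun k => (w k, (fst_part (pt k), snd_part (pt k)))) s).
split=> [t /List.in_map_iff[k [<- ks]]|].
  have /andP[wk _] : (0 < w k) && (k \in index_enum T).
    by rewrite -(mem_filter (fun k => 0 < w k)) -/s; elim: (s) ks => //= k' s' IH [->|/IH ks];
       rewrite inE ?eqxx // ks orbT.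
  by split; [apply/RleP/w0|apply: wS].
rewrite !List.map_map !fold_right_Rplus /=; split; last first.
  by split=> i; rewrite List.map_map fold_right_Rplus sumE e.
transitivity (\sum_(k <- s) w k * 1); first by apply: eq_bigr => k _; rewrite mulr1.
by rewrite sumE -[RHS]w1; apply: eq_bigr => k _; rewrite mulr1.
Qed.

Lemma conv_dot_le (S : mset p q) alpha beta gamma :
  (forall x y, S x y -> dot alpha x + dot beta y <= gamma) ->
  forall x y, conv S x y -> dot alpha x + dot beta y <= gamma.
Proof.
move=> hS x y [l [hl [l1 [hx hy]]]].
have wdot n (c u : 'I_n -> R) (v : R * (('I_p -> R) * ('I_q -> R)) -> 'I_n -> R) :
    (forall i, u i = \sum_(t <- l) t.1 * v t i) ->
    dot c u = \sum_(t <- l) t.1 * dot c (v t).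
  move=> hu; rewrite dotE.
  rewrite (eq_bigr _ (fun i _ => congr1 (fun t => c i * t) (hu i))).
  rewrite (eq_bigr _ (fun i _ => mulr_sumr _ _ _ _)) exchange_big /=.
  apply: eq_bigr => t _; rewrite dotE mulr_sumr; apply: eq_bigr => i _.
  by rewrite mulrCA.
rewrite (wdot _ _ _ (fun t => t.2.1)); last first.
  by move=> i; rewrite hx fold_right_Rplus.
rewrite (wdot _ _ _ (fun t => t.2.2)); last first.
  by move=> i; rewrite hy fold_right_Rplus.
rewrite -big_split -[gamma]mul1r -[X in _ <= X * _]l1 fold_right_Rplus mulr_suml /=.
elim: (l) hl => [|t l' IH] hl; first by rewrite !big_nil.
rewrite !big_cons lerD ?IH // => [|t' t'l]; last by apply: hl; right.
have [/RleP t0 /hS tS] := hl t (or_introl erefl).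
by rewrite -mulrDr ler_wpM2l.
Qed.

Lemma is_int_vecP n (x : 'I_n -> R) : is_int_vec x <-> forall i, x i \is a Num.int.
Proof.
split=> h i; first by have [m ->] := h i; rewrite IZR_Z intr_int.
by have /intrP[m ->] := h i; exists (Z_of_int m); rewrite IZR_int.
Qed.

(** A mixed integer point of [P] beyond a cut would violate every term of the disjunction, which is
    impossible. So each cut is valid at these points, and hence on their convex hull. *)
Lemma hull_sub_closure k (P : mset p q) x y : rational_polyhedron P ->
  mixed_integer_hull P x y -> k_disjunctive_closure k P x y.
Proof.
move=> [m [a [c [b [_ [_ [_ hP]]]]]]] hxy; split.
  apply/hP => j; apply/RleP; apply: (conv_dot_le _ hxy) => x' y' [].
  by move=> /hP/(_ j)/RleP.
move=> alpha beta gamma [_ [d [delta [[_ hd] hcut]]]]; apply/RleP.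
apply: (conv_dot_le _ hxy) => x' y' [Pxy /choice[n hn]].
rewrite leNgt; apply/negP => /RltP lt.
have [i] := hd n; have := hcut _ _ Pxy lt i.
rewrite (_ : (fun j => IZR (n j)) = x'); last by apply/funext => j; rewrite hn.
by move=> /Rgt_not_le.
Qed.

Lemma closure_sub_hull (P : mset p q) x y : (0 < p)%N -> rational_polyhedron P ->
  k_disjunctive_closure (2 ^ p) P x y -> mixed_integer_hull P x y.
Proof.
move=> p0 /rational_polyhedron_feasible[m [a [b hP]]] [Pxy cuts].
have [hs [hs_valid hs_hull]] := meyer R a b.
have PI z : feasible a b z /\ mixed_integer z ->
    P (fst_part z) (snd_part z) /\ is_int_vec (fst_part z).
  move=> [fz iz]; split; last exact/is_int_vecP.
  by apply/hP; congr feasible: fz; apply/funext => -[].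
suff : hull (fun z => feasible a b z /\ mixed_integer z) (join x y).
  move=> [T [w [pt [w0 wS w1 e]]]].
  apply: (@hull_conv (fun x y => P x y /\ is_int_vec x) (join x y)).
  by exists T, w, pt; split=> // k /wS/PI.
apply: hs_hull; apply/allP => h hh; rewrite leNgt; apply/negP => h0.
(* Scaling by [N] lifts the violation at (x, y) above 1, while the inequality stays valid at the
   mixed integer points. *)
pose N := Num.bound (idot h (homog (join x y)))^-1.
have Nh : 1 < N%:R * idot h (homog (join x y)).
  by rewrite -ltr_pdivrMr // mul1r archi_boundP // invr_ge0 ltW.
pose g k := N%:Z * h k.
have gE z : idot g (homog z) = N%:R * idot h (homog z).
  rewrite /idot mulr_sumr; apply: eq_bigr => k _.
  by rewrite /g rmorphM /= mulrA.
have [z hz|d [delta [hd hcut]]] := @disjunction_of_valid R _ _ _ a b g.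
  by rewrite gE mulr_ge0_le0 // (allP (hs_valid z hz)).
rewrite card_ord in d delta hd hcut.
have split_dot x' y' : dot (fun i => (g (Some (inl i)))%:~R) x' +
    dot (fun i => (g (Some (inr i)))%:~R) y' =
    idot g (homog (join x' y')) - (g None)%:~R.
  by rewrite idot_homog addrAC subrr add0r -(idot_dot (fun k => g (Some k))).
have above : 1 - (g None)%:~R < dot (fun i => (g (Some (inl i)))%:~R) x +
    dot (fun i => (g (Some (inr i)))%:~R) y by rewrite split_dot ltrD2r gE.
(* This is the cut g <= 1 with the constant term [g None] moved to the right-hand side; (x, y)
   violates it. *)
suff /cuts/RleP : is_k_disjunctive_cut (2 ^ p) P (fun i => (g (Some (inl i)))%:~R)
    (fun i => (g (Some (inr i)))%:~R) (1 - (g None)%:~R).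
  by apply/negP; rewrite -ltNge.
split.
  by move=> /(_ x y Pxy)/RleP; apply/negP; rewrite -ltNge.
exists (fun i j => Z_of_int (d i j)), (fun i => Z_of_int (delta i)); split.
  (* Here [0 < p] provides 2 <= 2^p. *)
  split; first by rewrite -[2%N]/(2 ^ 1)%N leq_exp2l.
  move=> x'; have [i hi] := hd (fun j => int_of_Z (x' j)); exists i; apply/RleP.
  rewrite dotE IZR_int; move: hi; rewrite -(ler_int R) rmorph_sum; congr (_ <= _).
  by apply: eq_bigr => j _; rewrite rmorphM /= IZR_int IZR_Z.
move=> x' y' /hP fz /RltP; rewrite RplusE split_dot ltrD2r => /ltW ge1 i; apply/RltP.
rewrite dotE IZR_int; apply: lt_le_trans (hcut _ fz ge1 i) _.
by rewrite le_eqVlt; apply/orP; left; apply/eqP/eq_bigr => j _; rewrite IZR_int.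
Qed.

End Bridge.

Theorem theorem2p6 (p q : nat) (P : mset p q) :
  rational_polyhedron P ->
  forall (x : 'I_p -> R) (y : 'I_q -> R),
    mixed_integer_hull P x y <-> k_disjunctive_closure (2 ^ p) P x y.
Proof.
move=> hP x y; split; first exact: hull_sub_closure.
case: p x P hP => [|p] x P hP; last exact: closure_sub_hull.
(* For p = 0 integrality is vacuous, so (x, y) alone, with weight 1, is the convex combination. *)
move=> [Pxy _]; exists [:: (1, (x, y))]; split=> [t [<-|[]]|] /=.
  by split; [apply: Rle_0_1|split=> // -[]].
by split; [|split=> i]; rewrite Rplus_0_r ?Rmult_1_l.
Qed.
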